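(* Let $g, h : \mathbb{R}^d \to [0,1]^c$ with components $g_i, h_i$, $i \in [c]$. Suppose that for all $i \in [c]$ the function $h_i$ is $\ell_p$-Lipschitz continuous with Lipschitz constant $\mathrm{Lip}_p(h_i)$, and let $x \in \mathbb{R}^d$ be arbitrary. Let $y = \arg\max_i h_i(x)$. For $\alpha \in [0,1]$ let $h^\alpha$ be the mixed classifier with components $h_i^\alpha(\cdot) = \log\big((1-\alpha) g_i(\cdot) + \alpha h_i(\cdot)\big)$, $i \in [c]$. Then, if $\alpha \in [\frac12, 1]$, it holds that $\arg\max_i h_i^\alpha(x+\delta) = y$ for all $\delta \in \mathbb{R}^d$ such that $$\|\delta\|_p \le r_p^\alpha(x) := \min_{i \ne y} \frac{\alpha\big(h_y(x) - h_i(x)\big) + \alpha - 1}{\alpha\big(\mathrm{Lip}_p(h_y) + \mathrm{Lip}_p(h_i)\big)}.$$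
   Context: Notation: $d$ is the input dimension, $c$ is the number of classes, $[c] = \{1, 2, \dots, c\}$, and $\|\cdot\|_p$ is the $\ell_p$ norm on $\mathbb{R}^d$. The functions $g$ (the standard base classifier) and $h$ (the robust base classifier) output class probabilities, so $0 \le g_i(\cdot) \le 1$ and $0 \le h_i(\cdot) \le 1$ for all $i$; no Lipschitzness or robustness is assumed of $g$. The class predicted by a model at an input is the element of $[c]$ given by the $\arg\max$ of its components there. A function $f : \mathbb{R}^d \to \mathbb{R}$ is called $\ell_p$-Lipschitz continuous if there exists $L \in (0,\infty)$ such that $|f(x') - f(x)| \le L \|x' - x\|_p$ for all $x', x \in \mathbb{R}^d$. The Lipschitz constant of such $f$ is $\mathrm{Lip}_p(f) := \inf\{L \in (0,\infty) : |f(x') - f(x)| \le L\|x'-x\|_p \text{ for all } x', x \in \mathbb{R}^d\}$. *)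

(* Defs.v *)
From mathcomp Require Import all_boot all_order all_algebra.
From mathcomp Require Import all_classical all_reals all_analysis.

Set Implicit Arguments.
Unset Strict Implicit.
Unset Printing Implicit Defensive.

Import Order.TTheory GRing.Theory Num.Theory.

Local Open Scope classical_set_scope.
Local Open Scope ring_scope.

(* The exponent p ranges over [1, +oo]; the value at p = -oo is junk. *)
Definition lp_norm (R : realType) (d : nat) (p : \bar R) (v : 'rV[R]_d) : R :=
  match p with
  | r%:E => (\sum_(i < d) `|v 0 i| `^ r) `^ r^-1
  | +oo%E => \big[Num.max/0]_(i < d) `|v 0 i|
  | -oo%E => 0
  end.

Definition lipschitz_bounds (R : realType) (d : nat) (p : \bar R)
    (f : 'rV[R]_d -> R) : set R :=
  [set L | 0 < L /\
           forall x' x : 'rV[R]_d, `|f x' - f x| <= L * lp_norm p (x' - x)].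

Definition lp_lipschitz (R : realType) (d : nat) (p : \bar R)
    (f : 'rV[R]_d -> R) : Prop :=
  exists L : R, lipschitz_bounds p f L.

(* Lip p f = 0 when f is constant. *)
Definition Lip (R : realType) (d : nat) (p : \bar R)
    (f : 'rV[R]_d -> R) : R :=
  inf (lipschitz_bounds p f).

(* "argmax_i F i = y", with ties allowed: y attains the maximum of F. *)
Definition is_argmax (disp : Order.disp_t) (T : porderType disp) (c : nat)
    (F : 'I_c -> T) (y : 'I_c) : Prop :=
  forall i : 'I_c, (F i <= F y)%O.

(* The argument of the logarithm may vanish: lne is the logarithm with values
   in the extended reals, lne 0 = -oo (whereas ln 0 = 0). *)
Definition mixed (R : realType) (d c : nat) (g h : 'rV[R]_d -> 'rV[R]_c)
    (alpha : R) (x : 'rV[R]_d) (i : 'I_c) : \bar R :=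
  lne ((1 - alpha) * g x 0 i + alpha * h x 0 i)%:E.

(* The quotient is taken in the extended reals, where 0^-1 = +oo and
   0 * +oo = 0: if h_y and h_i are both constant, the term is +oo, 0 or -oo
   according to the sign of the numerator. The minimum over an empty index set
   (c = 1) is +oo. *)
Definition robust_radius (R : realType) (d c : nat) (p : \bar R)
    (h : 'rV[R]_d -> 'rV[R]_c) (alpha : R) (y : 'I_c) (x : 'rV[R]_d) : \bar R :=
  (\big[mine/+oo]_(i < c | i != y)
    ((alpha * (h x 0 y - h x 0 i) + alpha - 1)%:E /
     (alpha * (Lip p (fun z => h z 0%R y) + Lip p (fun z => h z 0%R i)))%:E))%E.

(* Main.v *)
Require Import Defs.
From mathcomp Require Import all_boot all_order all_algebra.
From mathcomp Require Import all_classical all_reals all_analysis.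
From mathcomp Require Import lra.

(** Since the infimum defining the Lipschitz constant is itself a Lipschitz
    bound, the radius is exactly what makes
    [alpha * (h_y - h_i) >= 1 - alpha] at [x + delta] for every [i != y].  As
    the values of [g] lie in [[0, 1]], the base classifier contributes at least
    [- (1 - alpha)] to the difference of the two mixed components, so the
    margin stays nonnegative; the logarithm is monotone. *)

Set Implicit Arguments.
Unset Strict Implicit.
Unset Printing Implicit Defensive.

Import Order.TTheory GRing.Theory Num.Theory.

Local Open Scope ring_scope.

Lemma lp_norm_ge0 (R : realType) (d : nat) (p : \bar R) (v : 'rV[R]_d) :
  0 <= lp_norm p v.
Proof.
case: p => [r||] //=; first exact: powR_ge0.
by elim/big_ind: _ => // a b a0 b0; rewrite le_max a0.
Qed.

Lemma Lip_ge0 (R : realType) (d : nat) (p : \bar R) (f : 'rV[R]_d -> R) :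
  lp_lipschitz p f -> 0 <= Lip p f.
Proof. by move=> fL; apply: lb_le_inf => // L [/ltW]. Qed.

(** For a nonzero norm, the difference quotient is a lower bound of all admissible constants, hence
    at most their infimum. For norm zero, any one of them forces the increment to vanish. *)
Lemma Lip_bound (R : realType) (d : nat) (p : \bar R) (f : 'rV[R]_d -> R)
    (x' x : 'rV[R]_d) :
  lp_lipschitz p f -> `|f x' - f x| <= Lip p f * lp_norm p (x' - x).
Proof.
move=> fL; have := lp_norm_ge0 p (x' - x).
rewrite le_eqVlt => /predU1P[N0|N_gt0].
  by case: fL => L [_ /(_ x' x)]; rewrite -N0 !mulr0.
rewrite -ler_pdivrMr//; apply: lb_le_inf => // L [_ /(_ x' x)].
by rewrite ler_pdivrMr.
Qed.

(* For [b = 0] the quotient is [-oo] as soon as [a < 0]. *)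
Lemma lee_fin_div_mul (R : realType) (N a b : R) :
  0 <= b -> (N%:E <= a%:E / b%:E)%E -> N * b <= a.
Proof.
rewrite le_eqVlt => /predU1P[<-|b0].
  rewrite mulr0 inve0; case: (leP 0 a) => // a0.
  by rewrite lt0_muley ?lte_fin// leeNy_eq.
by rewrite inver gt_eqF// -EFinM lee_fin ler_pdivlMr.
Qed.

Theorem theorem4 (R : realType) (d c : nat) (p : \bar R) (hp : (1 <= p)%E)
    (g h : 'rV[R]_d -> 'rV[R]_c)
    (hg01 : forall (z : 'rV[R]_d) (i : 'I_c), 0 <= g z 0 i <= 1)
    (hh01 : forall (z : 'rV[R]_d) (i : 'I_c), 0 <= h z 0 i <= 1)
    (hLip : forall i : 'I_c, lp_lipschitz p (fun z => h z 0 i))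
    (x : 'rV[R]_d) (y : 'I_c) (hy : is_argmax (fun i => h x 0 i) y)
    (alpha : R) (halpha : 1 / 2 <= alpha <= 1) (delta : 'rV[R]_d)
    (hdelta : ((lp_norm p delta)%:E <= robust_radius p h alpha y x)%E) :
  is_argmax (mixed g h alpha (x + delta)) y.
Proof.
move=> i; have [->//|iy] := eqVneq i y.
have [a_gt0 a_le1] : 0 < alpha /\ alpha <= 1 by lra.
have mixed_ge0 j :
    0 <= (1 - alpha) * g (x + delta) 0 j + alpha * h (x + delta) 0 j.
  have /andP[g0 _] := hg01 (x + delta) j.
  have /andP[h0 _] := hh01 (x + delta) j.
  by rewrite addr_ge0// mulr_ge0// ?subr_ge0// ltW.
(* [lne] is monotone from zero on, its value [-oo] at zero included, so [mixed_ge0] lets the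
   logarithms be dropped. *)
rewrite /mixed lee_lne ?in_itv/= ?leey ?andbT ?lee_fin//.
have radius : lp_norm p delta *
    (alpha * (Lip p (fun z => h z 0 y) + Lip p (fun z => h z 0 i))) <=
    alpha * (h x 0 y - h x 0 i) + alpha - 1.
  apply: lee_fin_div_mul.
    by rewrite mulr_ge0 ?addr_ge0 ?Lip_ge0// ltW.
  apply: (le_trans hdelta); rewrite /robust_radius (bigD1 i)//=.
  by rewrite ge_min lexx.
have Hy := Lip_bound (x + delta) x (hLip y).
have Hi := Lip_bound (x + delta) x (hLip i).
rewrite [x + delta]addrC addrK -[delta + x]addrC in Hy Hi.
(* In the worst case component [y] drops and component [i] rises, so only the first difference is
   reversed. *)
move: Hy Hi; rewrite distrC => /(le_trans (ler_norm _)) Hy.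
move=> /(le_trans (ler_norm _)) Hi.
have {Hy Hi} := ler_wpM2l (ltW a_gt0) (lerD Hy Hi).
have gy : 0 <= (1 - alpha) * g (x + delta) 0 y.
  by rewrite mulr_ge0 ?subr_ge0//; case/andP: (hg01 (x + delta) y).
have gi : (1 - alpha) * g (x + delta) 0 i <= 1 - alpha.
  by rewrite ler_piMr ?subr_ge0//; case/andP: (hg01 (x + delta) i).
(* Linear once the products of [alpha] with the other quantities count as atoms. *)
move: radius gy gi; lra.
Qed.
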